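(* Let $(X,d)$ be a compact metric space, let $\mu_1,\mu_{-1}\in\mathscr{P}(X)$, and for $i=\pm1$ let $l_i:\mathbb{R}\to\mathbb{R}_+$ be convex and let $c_i:X\times X\to\mathbb{R}_+$ satisfy $c_i(x,x)=0$ for every $x\in X$. Assume that - $c_1$ and $c_{-1}$ are continuous on $X\times X$; - $l_1$ is nonincreasing and $l_{-1}$ is nondecreasing; - $\lim_{t\to-\infty}l_1(t)=\lim_{t\to+\infty}l_{-1}(t)=+\infty$. Then the minimization problem $$\inf_{h\in C(X)}\ \sum_{i=\pm1}\int_X\max_{z\in X}\{l_i(h(z))-c_i(x,z)\}\,\mathrm{d}\mu_i(x)$$ admits at least one solution $h\in C(X)$.
   Context: $\mathbb{R}_+=[0,+\infty)$; $\mathscr{P}(X)$ is the set of Borel probability measures on $X$ and $C(X)$ the set of continuous real-valued functions on $X$. The minimization problem is the classifier's problem in a zero-sum game between a classifier (choosing $h$) and an adversary; a solution is a continuous optimal strategy for the classifier. *)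

(* Defs.v *)
From HB Require Import structures.
From mathcomp Require Import all_boot all_order all_algebra.
From mathcomp Require Import all_classical all_reals all_analysis.
Import Order.TTheory GRing.Theory Num.Theory.
Import numFieldNormedType.Exports.

Set Implicit Arguments.
Unset Strict Implicit.
Unset Printing Implicit Defensive.

Local Open Scope classical_set_scope.
Local Open Scope ring_scope.

(* A [measurableType] is pointed. A space that carries a probability measure
   is nonempty, so asking for a point loses no generality. *)
#[short(type="pointedMetricType")]
HB.structure Definition PointedMetric (R : numDomainType) :=
  {X of Pointed X & Metric R X}.

Notation borelType X := (g_sigma_algebraType (@open X)).

Section AdversarialRisk.
Context {R : realType} {X : pointedMetricType R}.
Implicit Types (l : R -> R) (c : X * X -> R) (h : X -> R).

Definition adv_loss l c h (x : X) : R :=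
  sup (range (fun z : X => l (h z) - c (x, z))).

(* The supremum above is a maximum under the standing assumptions; convex
   functions on the whole line are continuous, whence the hypothesis on [l]. *)
Lemma adv_loss_max l c h (x : X) :
  compact [set: X] -> continuous l -> continuous c -> continuous h ->
  exists2 z, adv_loss l c h x = l (h z) - c (x, z) &
    forall y, l (h y) - c (x, y) <= l (h z) - c (x, z).
Proof.
move=> cX cl cc ch; pose f (z : X) := l (h z) - c (x, z).
have cf : continuous f.
  move=> z; apply: cvgB.
    by apply: (@continuous_comp _ _ _ h l); [exact: ch|exact: cl].
  apply: (@cvg_comp _ _ _ (fun z : X => (x, z)) c); last exact: cc.
  by apply: cvg_pair; [exact: cvg_cst|exact: cvg_id].
have [||z _ fz] := @compact_EVT_max X R f [set: X] _ cX.
- by exists point.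
- exact: continuous_subspaceT.
exists z => [|y]; last by apply: fz; rewrite inE.
apply/eqP; rewrite eq_le; apply/andP; split.
  apply: ge_sup; first by exists (f z); exists z.
  by move=> _ [y _ <-]; apply: fz; rewrite inE.
apply: ub_le_sup; last by exists z.
by exists (f z) => _ [y _ <-]; apply: fz; rewrite inE.
Qed.

Definition adv_risk (mu : probability (borelType X) R) l c h : \bar R :=
  (\int[mu]_x (adv_loss l c h x)%:E)%E.

End AdversarialRisk.

(* Main.v *)
Require Import Defs.
From mathcomp Require Import all_boot all_order all_algebra.
From mathcomp Require Import all_classical all_reals all_analysis.
From mathcomp Require Import measurable_realfun ring lra.
Import Order.TTheory GRing.Theory Num.Theory.
Import numFieldNormedType.Exports.

(** A minimizing sequence of continuous classifiers need not be equicontinuous,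
    so the direct method fails on [C(X)] itself.  The idea is to replace every
    competitor by a better one, taken from a fixed compact family.

    Let [g] be a continuous classifier, let [phi] be its adversarial loss for the
    first class, and let [psi z] be the infimum over [x] of [phi x + c1 (x, z)].
    The function [psi] dominates [l1 \o g], it yields the same adversarial loss
    as [l1 \o g], and its modulus of continuity is that of [c1], whatever [g] is.
    The smallest classifier whose loss is at most [psi] is [a \o psi], where [a]
    is the generalized inverse of [l1].  It lies below [g], so it does not
    increase the adversarial loss of the second class, whose loss function is
    nondecreasing ([equicontinuous_replacement]).

    Two points remain.  First, [a] must be continuous and independent of [g].
    Since the costs are bounded and the losses blow up on opposite sides, every
    [g] that does at least as well as the zero classifier takes its values in a
    fixed segment [[A, B]] ([le_adv_risk]); then [psi] takes its values in
    [[l1 B, l1 A]], and convexity makes the generalized inverse of [l1] continuous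
    there ([nonincreasing_convex_inverse]).  Secondly, a minimum must exist among
    the [a \o psi].  The functions [psi] range over a bounded equicontinuous
    family, which is compact, and the risk of [a \o psi] is continuous in [psi]
    for the uniform distance ([equicontinuous_family_argmin],
    [total_risk_uniform_dist]). *)

Set Implicit Arguments.
Unset Strict Implicit.
Unset Printing Implicit Defensive.

Local Open Scope classical_set_scope.
Local Open Scope ring_scope.

(** * Convex functions of one real variable *)

Lemma convex_function_chord (R : realType) (l : R -> R) (x y z : R) :
  convex_function (setT : set R) l -> x <= y -> y <= z ->
  (z - x) * l y <= (z - y) * l x + (y - x) * l z.
Proof.
move=> lcvx xy yz.
have [zx|xz] := eqVneq x z.
  by have -> : y = x by [apply/eqP; rewrite eq_le {1}zx yz]; rewrite -zx; lra.
have {}xz : 0 < z - x by rewrite subr_gt0 lt_neqAle xz (le_trans xy).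
have t01 : 0 <= (z - y) / (z - x) <= 1.
  rewrite divr_ge0 ?subr_ge0 ?(le_trans xy)//=.
  by rewrite ler_pdivrMr// mul1r lerB.
pose t : {i01 R} := Itv01 (proj1 (andP t01)) (proj2 (andP t01)).
have := lcvx t x z (mem_set I) (mem_set I).
rewrite !convRE /= /unstable.onem => H.
have yE : (z - y) / (z - x) * x + (1 - (z - y) / (z - x)) * z = y.
  by field; rewrite gt_eqF.
have {}H : l ((z - y) / (z - x) * x + (1 - (z - y) / (z - x)) * z) <=
    (z - y) / (z - x) * l x + (1 - (z - y) / (z - x)) * l z := H.
rewrite yE in H.
have := ler_wpM2l (ltW xz) H.
move=> /le_trans; apply.
by rewrite le_eqVlt; apply/orP; left; apply/eqP; field; rewrite gt_eqF.
Qed.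

(** Convexity traps [l y], for [y] within distance [1] of [x], between the chord
    from [x] to the endpoint [x + 1] or [x - 1] on the side of [y] and the
    extension of the chord from the opposite endpoint through [x].  Both are
    Lipschitz in [y], which makes [l] Lipschitz at [x]. *)
Lemma convex_function_continuous (R : realType) (l : R -> R) :
  convex_function (setT : set R) l -> continuous l.
Proof.
move=> lcvx; rewrite /continuous_at => x.
pose M := `|l (x + 1) - l x| + `|l (x - 1) - l x|.
have M0 : 0 <= M by rewrite addr_ge0.
have key y : `|x - y| <= 1 -> `|l x - l y| <= `|x - y| * M.
  rewrite ler_norml => /andP[xy1 xy2].
  have := ler_norm (l (x + 1) - l x); have := ler_norm (l (x - 1) - l x).
  have := normr_ge0 (l (x + 1) - l x); have := normr_ge0 (l (x - 1) - l x).
  rewrite /M; set a := `|l (x + 1) - _|; set b := `|l (x - 1) - _|.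
  move=> b0 a0 lb la.
  have [xy|/ltW yx] := leP x y.
    have h1 : (x + 1 - x) * l y <= (x + 1 - y) * l x + (y - x) * l (x + 1).
      by apply: convex_function_chord lcvx xy _; lra.
    have h2 : (y - (x - 1)) * l x <= (y - x) * l (x - 1) + (x - (x - 1)) * l y.
      by apply: convex_function_chord lcvx _ xy; lra.
    rewrite (ler0_norm (_ : x - y <= 0)); last lra.
    by rewrite ler_norml; apply/andP; split; nra.
  have h1 : (x - (x - 1)) * l y <= (x - y) * l (x - 1) + (y - (x - 1)) * l x.
    by apply: convex_function_chord lcvx _ yx; lra.
  have h2 : (x + 1 - y) * l x <= (x + 1 - x) * l y + (x - y) * l (x + 1).
    by apply: convex_function_chord lcvx yx _; lra.
  rewrite (ger0_norm (_ : 0 <= x - y)); last lra.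
  by rewrite ler_norml; apply/andP; split; nra.
apply/cvgrPdist_le => e e0.
have d0 : 0 < Num.min 1 (e / (M + 1)) by rewrite lt_min ltr01 divr_gt0// ltr_wpDl.
near=> y.
have : `|x - y| < Num.min 1 (e / (M + 1)).
  by near: y; exact: (@cvgr_dist_lt _ _ _ _ _ id x cvg_id _ d0).
rewrite lt_min => /andP[xy1 xye].
apply: (le_trans (key _ (ltW xy1))).
rewrite ltr_pdivlMr in xye; last by rewrite ltr_wpDl.
by apply: le_trans (ltW xye); rewrite ler_wpM2l// lerDl.
Unshelve. all: by end_near. Qed.

(** Let [b] be the least point of [[A, B]] where [l] reaches the value [l B].
    Convexity makes [l] strictly decreasing on [[A, b]], since a plateau that
    starts before [b] would force [l] to have reached [l B] there.  Hence [l] is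
    a homeomorphism from [[A, b]] to [[l B, l A]]; its inverse, precomposed with
    the truncation to [[l B, l A]], is continuous on the whole line, and it
    sends a level [s] to the smallest point of [[A, +oo[] where [l] is at most
    [s].  Without convexity this generalized inverse can jump at a
    plateau. *)
Lemma nonincreasing_convex_inverse (R : realType) (l : R -> R) (A B : R) :
  convex_function (setT : set R) l -> nonincreasing_fun l -> A <= B ->
  exists a : R -> R, [/\ continuous a,
    forall s, l B <= s <= l A -> l (a s) = s &
    forall s t, l B <= s <= l A -> A <= t -> l t <= s -> a s <= t].
Proof.
move=> lcvx lni AB.
have lcts : continuous l by exact: convex_function_continuous.
have lle x y : x <= y -> l y <= l x by move/lni.
have [b [[Ab bB lbB] bmin]] : exists b, [/\ A <= b, b <= B & l b <= l B] /\
    forall t, A <= t -> t <= B -> l t <= l B -> b <= t.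
  pose D := `[A, B]%classic `&` l @^-1` [set y | y <= l B].
  have cD : compact D.
    apply: (subclosed_compact _ (@segment_compact _ A B)); last by move=> ? [].
    apply: closedI; first exact: itv_closed.
    by apply: closed_comp; [move=> ? _; exact: lcts|exact: closed_le].
  have [||b] := @compact_EVT_min R R id D _ cD.
  - by exists B; split => /=; rewrite ?in_itv/= ?AB ?lexx.
  - by apply: continuous_subspaceT => ?; exact: cvg_id.
  rewrite inE => -[/=]; rewrite in_itv/= => /andP[Ab bB] lb bmin.
  exists b; split => // t At tB ltB; apply: bmin; rewrite inE; split => //=.
  by rewrite in_itv/= At.
have lbE : l b = l B by apply/eqP; rewrite eq_le lbB lle.
have lsd x y : A <= x -> x < y -> y <= b -> l y < l x.
  move=> Ax xy yb; rewrite lt_neqAle lle ?(ltW xy)// andbT; apply/eqP => lyx.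
  have [yB|By] := ltP y B; last first.
    have : b <= x by apply: bmin => //; [|rewrite -lyx lle]; lra.
    by move=> ?; lra.
  have xB : l x <= l B.
    have := convex_function_chord lcvx (ltW xy) (ltW yB).
    by rewrite lyx; nra.
  by have : b <= x by [apply: bmin => //; lra]; lra.
have linj x y : A <= x <= b -> A <= y <= b -> l x = l y -> x = y.
  move=> /andP[Ax xb] /andP[Ay yb] lxy.
  have [xy|yx|//] := ltgtP x y.
    by have := lsd _ _ Ax xy yb; rewrite lxy ltxx.
  by have := lsd _ _ Ay yx xb; rewrite lxy ltxx.
pose g s := xget A [set t | A <= t <= b /\ l t = s].
have gK : {in `[A, b], cancel l g}.
  move=> t; rewrite in_itv/= => tAb; rewrite /g.
  by case: xgetP => [y -> [yAb lyt]|/(_ t) []//]; exact: linj.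
have lwc : {within `[A, b], continuous l} by exact: continuous_subspaceT.
have gc := segment_can_ge_continuous Ab lwc gK.
have lbA : l b <= l A by exact: lle.
(* [k] truncates to the segment of the values of [l]. *)
pose k s := Num.max (l b) (Num.min s (l A)).
have kin s : l b <= k s <= l A.
  by rewrite /k le_max lexx/= ge_max lbA/= ge_min lexx orbT.
have kid s : l b <= s <= l A -> k s = s.
  by move=> /andP[bs sA]; rewrite /k min_l// max_r.
have kc : continuous k.
  move=> s; apply: (@continuous_max _ _ (cst (l b)) (fun s => Num.min s (l A))).
    exact: cvg_cst.
  by apply: (@continuous_min _ _ id (cst (l A))); [exact: cvg_id|exact: cvg_cst].
have gP s : l b <= s <= l A -> A <= g s <= b /\ l (g s) = s.
  move=> sb; rewrite /g; case: xgetP => [y -> //|].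
  have [|t tAb lts] := @segment_continuous_ge_surjective _ A b l Ab lbA lwc s.
    by rewrite /= in_itv.
  by move=> /(_ t); rewrite /= in_itv/= in tAb *; case.
exists (g \o k); split.
- move=> s; apply: (@cvg_comp _ _ _ k g _ (within `[l b, l A] (nbhs (k s)))).
    move=> U; rewrite /within /= => UV.
    have : nbhs s (k @^-1` [set y | y \in `[l b, l A] -> U y]) by exact: kc UV.
    by apply: filterS => t /=; apply; rewrite in_itv; exact: kin.
  have /subspace_continuousP := gc; apply.
  by rewrite /= in_itv; exact: kin.
- by move=> s; rewrite -lbE => sb; rewrite /= kid//; case: (gP _ sb).
move=> s t; rewrite -lbE => sb At lts; rewrite /= kid//.
have [/andP[Ag gb] lg] := gP _ sb.
by rewrite leNgt; apply/negP => /(lsd _ _ At)/(_ gb); rewrite lg ltNge lts.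
Qed.

(** * Minimization over an equicontinuous family of functions *)

Section EquicontinuousFamily.
Context {R : realType} {X : topologicalType}.
Context (p q : R) (omega : X -> X -> R).

Definition equicontinuous_family : set (X -> R) :=
  [set f | (forall x, p <= f x <= q) /\ forall x y, `|f x - f y| <= omega x y].

(** The constraints are closed for pointwise convergence, and they cut the
    family out of the product of the segments [[p, q]], which is compact by
    Tychonoff's theorem. *)
Lemma compact_equicontinuous_family :
  compact (equicontinuous_family : set {ptws X -> R}).
Proof.
have pcts x : continuous (fun f : {ptws X -> R} => f x) by exact: proj_continuous.
have cB : compact [set f : {ptws X -> R} | forall x, `[p, q]%classic (f x)].
  exact: (@tychonoff X (fun=> R) (fun=> `[p, q]%classic)
    (fun=> @segment_compact R p q)).
apply: (subclosed_compact _ cB); last first.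
  by move=> f [fb _] x; rewrite /= in_itv/= fb.
pose D (u : X * X) := (fun f : {ptws X -> R} => `|f u.1 - f u.2|) @^-1`
  [set t | t <= omega u.1 u.2].
pose B x := (fun f : {ptws X -> R} => f x) @^-1` `[p, q]%classic.
rewrite [X in closed X](_ : _ = \bigcap_x B x `&` \bigcap_u D u).
  apply: closedI; apply: closed_bigI.
    move=> x _; apply: closed_comp; last exact: itv_closed.
    by move=> f _; exact: pcts.
  move=> u _; apply: closed_comp; last exact: closed_le.
  move=> f _; have p1 := pcts u.1 f; have p2 := pcts u.2 f.
  exact: (cvg_norm (cvgB p1 p2 : _ @ nbhs f --> _)).
apply/seteqP; split=> [f [fb fw]|f [fb fw]].
  split=> [x _|u _]; last exact: fw.
  by rewrite /B/= in_itv/= fb.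
split=> [x|x y]; last by have := fw (x, y) I.
by have := fb x I; rewrite /B/= in_itv.
Qed.

Context (cX : compact [set: X])
  (omega_small : forall x (e : R), 0 < e -> \forall y \near x, omega x y <= e).

Lemma equicontinuous_family_continuous f : equicontinuous_family f -> continuous f.
Proof.
move=> [_ fw] x; apply/cvgrPdist_le => e e0.
by apply: filterS (omega_small x e0) => y; exact: le_trans.
Qed.

(** This is the direct method.  Compactness is only available for pointwise
    convergence, but on an equicontinuous family over a compact space pointwise
    and uniform convergence agree, so continuity for the uniform distance, which
    integral functionals have, is enough. *)
Lemma equicontinuous_family_argmin (F : (X -> R) -> R) :
  equicontinuous_family !=set0 ->
  (forall f (e : R), equicontinuous_family f -> 0 < e -> exists2 d : R, 0 < d &
    forall g, equicontinuous_family g -> (forall x, `|f x - g x| < d) ->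
      `|F f - F g| <= e) ->
  exists2 f, equicontinuous_family f &
    forall g, equicontinuous_family g -> F f <= F g.
Proof.
move=> K0 Fcts; pose K : set {ptws X -> R} := equicontinuous_family.
have [|f fK fmin] := @compact_EVT_min {ptws X -> R} R F K K0
  compact_equicontinuous_family.
  apply/subspace_continuousP => f fK; apply/cvgrPdist_le => e e0.
  have [d d0 dF] := Fcts f e fK e0.
  have : \forall g \near within K (nbhs (f : {ptws X -> R})),
      [set: X] `<=` (fun x => `|f x - g x| < d).
    (* Closeness of [g] to [f] at [x] propagates to a neighbourhood of [x]
       through the common modulus [omega], hence to [X] by compactness. *)
    apply: (compact_near_coveringP _).1 => // x _.
    have d4 : 0 < d / 4 by rewrite divr_gt0.
    have nx := omega_small x d4.
    have ng : \forall g \near within K (nbhs (f : {ptws X -> R})),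
        `|f x - g x| <= d / 4.
      apply: cvg_within; have : (fun f : {ptws X -> R} => f x) @ f --> f x.
        exact: proj_continuous.
      by move/cvgrPdist_le; apply.
    have nK : \forall g \near within K (nbhs (f : {ptws X -> R})), K g.
      exact: withinT.
    near=> x' g => /=.
    have h1 : `|f x - f x'| <= d / 4 by apply: le_trans (fK.2 _ _) _; near: x'.
    have h3 : `|f x - g x| <= d / 4 by near: g.
    have gK : K g by near: g.
    have h2 : `|g x - g x'| <= d / 4 by apply: le_trans (gK.2 _ _) _; near: x'.
    move: h1 h2 h3; rewrite !ler_norml ltr_norml => /andP[? ?] /andP[? ?] /andP[? ?].
    by apply/andP; split; lra.
  have : \forall g \near within K (nbhs (f : {ptws X -> R})), K g.
    exact: withinT.
  by apply: filterS2 => g gK gf; apply: dF => // x; exact: gf.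
exists f; first by rewrite inE in fK.
by move=> g gK; apply: fmin; rewrite inE.
Unshelve. all: by end_near. Qed.

End EquicontinuousFamily.

(** Only the compact range of [f] matters: composing on the left with a
    continuous function [u] is continuous at [f] for the uniform distance, even
    though [u] need not be uniformly continuous on the line. *)
Lemma comp_uniform_dist (R : realType) (X : topologicalType) (f : X -> R)
    (u : R -> R) (e : R) :
  compact [set: X] -> continuous f -> continuous u -> 0 < e ->
  exists2 d : R, 0 < d & forall g : X -> R, (forall x, `|f x - g x| < d) ->
    forall x, `|u (f x) - u (g x)| <= e.
Proof.
move=> cX fc uc e0.
have : \forall d \near (0:R)^'+, [set: X] `<=`
    (fun x => forall y, `|f x - y| < d -> `|u (f x) - u y| <= e).
  apply: (compact_near_coveringP _).1 => // x _.
  have e2 : 0 < e / 2 by rewrite divr_gt0.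
  have /cvgrPdist_le/(_ _ e2)/nbhs_ballP[r /= r0 ur] := uc (f x).
  have r2 : 0 < r / 2 by rewrite divr_gt0.
  have uf y : `|f x - y| < r -> `|u (f x) - u y| <= e / 2 by move=> ?; exact: ur.
  have nx : \forall x' \near x, `|f x - f x'| < r / 2.
    by have /cvgrPdist_lt := fc x; apply.
  have nd : \forall d \near (0:R)^'+, d < r / 2 by exact: nbhs_right_lt.
  near=> x' d => /= y fy.
  have h1 : `|f x - f x'| < r / 2 by near: x'.
  have h2 : d < r / 2 by near: d.
  have h3 : `|f x - y| < r.
    rewrite (splitr r) -(subrKA (f x')) (le_lt_trans (ler_normD _ _))//.
    by rewrite ltrD// (lt_trans fy).
  have h4 : `|f x - f x'| < r by apply: (lt_trans h1); lra.
  rewrite (splitr e) -(subrKA (u (f x))) (le_trans (ler_normD _ _))//.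
  by rewrite lerD//; [rewrite distrC|]; exact: uf.
move=> nd; near (0:R)^'+ => d; exists d => // g fg x.
have dP : [set: X] `<=` (fun x => forall y, `|f x - y| < d -> `|u (f x) - u y| <= e).
  by near: d.
exact: dP.
Unshelve. all: by end_near. Qed.

(** * The adversarial loss *)

Section CostModulus.
Context {R : realType} {X : pointedMetricType R}.
Context (c : X * X -> R) (cX : compact [set: X]) (cc : continuous c).

(** This modulus depends on the cost alone.  It bounds the oscillation of every
    adversarial loss, whatever the classifier, and so is what makes families of
    losses equicontinuous. *)
Definition cost_modulus (x y : X) : R :=
  sup (range (fun w => `|c (x, w) - c (y, w)|)).

Lemma cost_bounded : exists C : R, forall p, `|c p| <= C.
Proof.
have cXX : compact [set: X * X].
  by rewrite -setXTT; exact: compact_setX.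
have [||p _ pmax] := @compact_EVT_max (X * X)%type R (fun p => `|c p|) _ _ cXX.
- by exists point.
- by apply: continuous_subspaceT => p; exact: (cvg_norm (cc (x := p))).
by exists `|c p| => p'; apply: pmax; rewrite inE.
Qed.

Lemma cost_modulus_ub x y w : `|c (x, w) - c (y, w)| <= cost_modulus x y.
Proof.
have [C cC] := cost_bounded.
apply: ub_le_sup; last by exists w.
exists (C + C) => _ [v _ <-].
by rewrite (le_trans (ler_normB _ _))// lerD.
Qed.

Lemma cost_modulus_small x (e : R) : 0 < e -> \forall y \near x, cost_modulus x y <= e.
Proof.
move=> e0.
have : \forall y \near x, [set: X] `<=` (fun w => `|c (x, w) - c (y, w)| <= e).
  apply: (compact_near_coveringP _).1 => // w _.
  have e2 : 0 < e / 2 by rewrite divr_gt0.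
  have /cvgrPdist_le/(_ _ e2)[[U V] /= [xU wV] UV] := cc (x := (x, w)).
  exists (V, U) => // -[w' y]/= [w'V yU].
  rewrite (splitr e) -(subrKA (c (x, w))) (le_trans (ler_normD _ _))// lerD//.
    by rewrite distrC; apply: (UV (x, w')); split => //; exact: nbhs_singleton.
  exact: (UV (y, w')).
apply: filterS => y xy; apply: ge_sup.
  by exists `|c (x, point) - c (y, point)|; exists point.
by move=> _ [w _ <-]; exact: xy.
Qed.

End CostModulus.

Section AdvLoss.
Context {R : realType} {X : pointedMetricType R}.
Context (cX : compact [set: X]).
Implicit Types (l : R -> R) (c : X * X -> R) (h : X -> R).

Lemma adv_loss_ub l c h x z : continuous l -> continuous c -> continuous h ->
  l (h z) - c (x, z) <= adv_loss l c h x.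
Proof. by move=> cl cc ch; have [y -> ] := adv_loss_max x cX cl cc ch. Qed.

Lemma adv_loss_lub l c h x (M : R) :
  (forall z, l (h z) - c (x, z) <= M) -> adv_loss l c h x <= M.
Proof.
move=> lM; apply: ge_sup; first by exists (l (h point) - c (x, point)); exists point.
by move=> _ [z _ <-]; exact: lM.
Qed.

Lemma adv_loss_ge0 l c h x : continuous l -> continuous c -> continuous h ->
  (forall t, 0 <= l t) -> c (x, x) = 0 -> 0 <= adv_loss l c h x.
Proof.
move=> cl cc ch l0 cxx; apply: le_trans (adv_loss_ub x x cl cc ch).
by rewrite cxx subr0.
Qed.

Lemma adv_loss_le_cost l c h x y : continuous l -> continuous c -> continuous h ->
  adv_loss l c h x <= adv_loss l c h y + cost_modulus c x y.
Proof.
move=> cl cc ch; apply: adv_loss_lub => z.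
have := adv_loss_ub y z cl cc ch.
have := cost_modulus_ub cX cc x y z; rewrite ler_norml => /andP[? ?].
by move=> ?; lra.
Qed.

Lemma cost_modulusC c x y : cost_modulus c x y = cost_modulus c y x.
Proof.
by congr sup; apply/seteqP; split=> _ [w _ <-]; exists w => //; rewrite distrC.
Qed.

(** A supremum of functions of [x] that share the modulus of continuity
    [cost_modulus c] has that modulus as well; no regularity of [h] enters the
    bound. *)
Lemma adv_loss_equicontinuous l c h x y :
  continuous l -> continuous c -> continuous h ->
  `|adv_loss l c h x - adv_loss l c h y| <= cost_modulus c x y.
Proof.
move=> cl cc ch; rewrite ler_norml.
have := adv_loss_le_cost x y cl cc ch; have := adv_loss_le_cost y x cl cc ch.
by rewrite (cost_modulusC c y x) => ? ?; apply/andP; split; lra.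
Qed.

Lemma adv_loss_continuous l c h : continuous l -> continuous c -> continuous h ->
  continuous (adv_loss l c h).
Proof.
move=> cl cc ch x; apply/cvgrPdist_le => e e0.
apply: filterS (cost_modulus_small cX cc x e0) => y; apply: le_trans.
exact: adv_loss_equicontinuous.
Qed.

Lemma adv_loss_le l c h h' x (e : R) :
  continuous l -> continuous c -> continuous h' ->
  (forall z, l (h z) <= l (h' z) + e) ->
  adv_loss l c h x <= adv_loss l c h' x + e.
Proof.
move=> cl cc ch hh'; apply: adv_loss_lub => z.
by have := adv_loss_ub x z cl cc ch; have := hh' z; lra.
Qed.

End AdvLoss.

(** * The adversarial risk *)

Lemma probability_integral_cst d (T : measurableType d) (R : realType)
    (P : probability T R) (e : R) : (\int[P]_x (cst e%:E x) = e%:E)%E.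
Proof.
rewrite integral_cst// [X in (_ * X)%E](_ : _ = 1%E) ?mule1//.
exact: probability_setT.
Qed.

Lemma probability_le_integral d (T : measurableType d) (R : realType)
    (P : probability T R) (f g : T -> R) (e : R) :
  measurable_fun setT f -> measurable_fun setT g ->
  (forall x, 0 <= f x) -> (forall x, 0 <= g x) ->
  0 <= e -> (forall x, f x <= g x + e) ->
  (\int[P]_x (f x)%:E <= \int[P]_x (g x)%:E + e%:E)%E.
Proof.
move=> /measurable_EFinP mf /measurable_EFinP mg f0 g0 e0 fg.
rewrite -[in leRHS](probability_integral_cst P e) -ge0_integralD//; last first.
  by move=> x _; rewrite lee_fin.
apply: ge0_le_integral => //.
- by move=> x _; rewrite lee_fin.
- by apply: emeasurable_funD => //; exact: measurable_cst.
by move=> x _; rewrite -EFinD lee_fin.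
Qed.

Section AdvRisk.
Context {R : realType} {X : pointedMetricType R}.
Context (mu : probability (borelType X) R).

Lemma continuous_borel_measurable (f : X -> R) : continuous f ->
  measurable_fun [set: borelType X] (f : borelType X -> R).
Proof.
move=> /continuousP cf; apply: (measurability _ (RGenOpens.measurableE R)).
move=> _ [_ [a [b ->] <-]]; rewrite setTI.
by apply: sub_sigma_algebra; apply: cf; exact: interval_open.
Qed.

Lemma continuous_le_integral (f g : X -> R) (e : R) :
  continuous f -> continuous g -> (forall x, 0 <= f x) -> (forall x, 0 <= g x) ->
  0 <= e -> (forall x, f x <= g x + e) ->
  (\int[mu]_x (f x)%:E <= \int[mu]_x (g x)%:E + e%:E)%E.
Proof.
move=> /continuous_borel_measurable mf /continuous_borel_measurable mg f0 g0 e0 fg.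
exact: (probability_le_integral mu mf mg f0 g0 e0 fg).
Qed.

Context (l : R -> R) (c : X * X -> R) (cX : compact [set: X])
  (cl : continuous l) (cc : continuous c)
  (l0 : forall t, 0 <= l t) (c0 : forall p, 0 <= c p)
  (cxx : forall x, c (x, x) = 0).
Implicit Types h : X -> R.

Lemma adv_risk_le_adv_loss h h' (e : R) : continuous h -> continuous h' -> 0 <= e ->
  (forall x, adv_loss l c h x <= adv_loss l c h' x + e) ->
  (adv_risk mu l c h <= adv_risk mu l c h' + e%:E)%E.
Proof.
move=> ch ch' e0 hh'; apply: continuous_le_integral => //; try exact: adv_loss_continuous.
  by move=> x; exact: adv_loss_ge0.
by move=> x; exact: adv_loss_ge0.
Qed.

Lemma adv_risk_le h h' (e : R) : continuous h -> continuous h' -> 0 <= e ->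
  (forall z, l (h z) <= l (h' z) + e) ->
  (adv_risk mu l c h <= adv_risk mu l c h' + e%:E)%E.
Proof.
move=> ch ch' e0 hh'; apply: adv_risk_le_adv_loss => // x.
exact: adv_loss_le.
Qed.

Lemma adv_risk_ge0 h : continuous h -> (0 <= adv_risk mu l c h)%E.
Proof.
by move=> ch; apply: integral_ge0 => x _; rewrite lee_fin adv_loss_ge0.
Qed.

Lemma adv_risk_fin_num h : continuous h -> adv_risk mu l c h \is a fin_num.
Proof.
move=> ch; rewrite ge0_fin_numE ?adv_risk_ge0//.
have [||z _ zmax] := @compact_EVT_max X R (l \o h) _ _ cX.
- by exists point.
- by apply: continuous_subspaceT => x; apply: continuous_comp; [exact: ch|exact: cl].
apply: (@le_lt_trans _ _ (\int[mu]_x ((fun=> 0) x)%:E + (l (h z))%:E)%E).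
  apply: continuous_le_integral => //; [exact: adv_loss_continuous|by move=> ?; exact: cvg_cst| |].
    by move=> x; exact: adv_loss_ge0.
  move=> x; rewrite add0r; apply: adv_loss_lub => y.
  rewrite lerBlDr (le_trans (zmax y _)) ?inE//= lerDl//.
by rewrite integral0 add0e ltry.
Qed.

(** The adversary can reach any [z] from every [x] at cost at most [C], so the
    risk controls the pointwise values of [l \o h].  This gives coercivity:
    classifiers of bounded risk are uniformly bounded. *)
Lemma le_adv_risk h (C : R) z : continuous h -> (forall p, `|c p| <= C) ->
  ((l (h z))%:E <= adv_risk mu l c h + C%:E)%E.
Proof.
move=> ch cC.
have <- : (\int[mu]_x ((fun=> l (h z)) x)%:E = (l (h z))%:E)%E.
  exact: probability_integral_cst.
apply: continuous_le_integral => //; [by move=> ?; exact: cvg_cst|exact: adv_loss_continuous| | |].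
- by move=> x; exact: adv_loss_ge0.
- by rewrite (le_trans _ (cC (point, point))).
move=> x; have := adv_loss_ub cX x z cl cc ch; have := cC (x, z).
by rewrite ger0_norm// => ? ?; lra.
Qed.

End AdvRisk.

(** * Replacing a classifier by an equicontinuous one *)

Section CTransform.
Context {R : realType} {X : pointedMetricType R}.
Context (c : X * X -> R) (cX : compact [set: X]) (cc : continuous c).

Definition swap_cost (p : X * X) : R := c (p.2, p.1).

Lemma swap_cost_continuous : continuous swap_cost.
Proof.
move=> p; apply: (@cvg_comp _ _ _ (fun p : X * X => (p.2, p.1)) c); last exact: cc.
by apply: cvg_pair; [exact: cvg_snd|exact: cvg_fst].
Qed.

(** This is the infimum over [x] of [phi x + c (x, z)], as in optimal transport.
    Writing it as the opposite of an adversarial loss for the swapped cost lets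
    the results on adversarial losses apply to it. *)
Definition c_transform (phi : X -> R) (z : X) : R :=
  - adv_loss id swap_cost (fun x => - phi x) z.

Section Continuous.
Context (phi : X -> R) (cphi : continuous phi).

Let cNphi : continuous (fun x => - phi x).
Proof. by move=> x; apply: cvgN; exact: cphi. Qed.

Let cid : continuous (@id R).
Proof. by move=> x; exact: cvg_id. Qed.

Lemma c_transform_le x z : c_transform phi z <= phi x + c (x, z).
Proof.
have := adv_loss_ub cX z x cid swap_cost_continuous cNphi.
by rewrite /c_transform /swap_cost/= => ?; lra.
Qed.

Lemma c_transform_equicontinuous y z :
  `|c_transform phi y - c_transform phi z| <= cost_modulus swap_cost y z.
Proof.
have := adv_loss_equicontinuous cX y z cid swap_cost_continuous cNphi.
by rewrite distrC /c_transform opprK addrC.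
Qed.

End Continuous.

Lemma le_c_transform phi z (s : R) :
  (forall x, s <= phi x + c (x, z)) -> s <= c_transform phi z.
Proof.
move=> sphi; rewrite lerNr; apply: adv_loss_lub => x.
by have := sphi x; rewrite /swap_cost/= => ?; lra.
Qed.

End CTransform.

(** Let [phi] be the adversarial loss of [g] and [psi] its c-transform.  By
    construction [psi] is the largest function such that
    [psi z - c (x, z) <= phi x] for all [x] and [z].  Thus [l \o g <= psi], and
    a classifier whose loss is exactly [psi], such as [a \o psi], has an
    adversarial loss at most [phi].  As [a] picks the smallest value with loss at
    most [psi z], replacing [g] by [a \o psi] only lowers the classifier, which
    can only help against the opposite class. *)
Lemma equicontinuous_replacement (R : realType) (X : pointedMetricType R)
    (l : R -> R) (c : X * X -> R) (A B : R) (a : R -> R) (g : X -> R) :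
  compact [set: X] -> continuous l -> nonincreasing_fun l -> continuous c ->
  (forall p, 0 <= c p) -> (forall x, c (x, x) = 0) ->
  (forall s, l B <= s <= l A -> l (a s) = s) ->
  (forall s t, l B <= s <= l A -> A <= t -> l t <= s -> a s <= t) ->
  continuous g -> (forall x, A <= g x <= B) ->
  exists psi, [/\ equicontinuous_family (l B) (l A) (cost_modulus (swap_cost c)) psi,
    forall z, a (psi z) <= g z &
    forall x, adv_loss l c (a \o psi) x <= adv_loss l c g x].
Proof.
move=> cX cl lni cc c0 cxx la amin cg gAB.
pose phi := adv_loss l c g; pose psi := c_transform c phi.
have cphi : continuous phi by exact: adv_loss_continuous.
have lgpsi z : l (g z) <= psi z.
  by apply: le_c_transform => x; rewrite -lerBlDr; exact: adv_loss_ub.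
have psib z : l B <= psi z <= l A.
  apply/andP; split.
    by apply: le_trans (lgpsi z); apply: lni; have /andP[] := gAB z.
  apply: (le_trans (c_transform_le cX cc cphi z z)); rewrite cxx addr0.
  apply: adv_loss_lub => y; rewrite lerBlDr (@le_trans _ _ (l A))//.
    by apply: lni; have /andP[] := gAB y.
  by rewrite lerDl.
exists psi; split.
- by split => // y z; exact: c_transform_equicontinuous.
- by move=> z; apply: amin => //; have /andP[] := gAB z.
move=> x; apply: adv_loss_lub => z; rewrite /= la// lerBlDr.
exact: c_transform_le.
Qed.

(** * The two-class problem *)

Section Classifier.
Context {R : realType} {X : pointedMetricType R}.
Context (mu1 mum1 : probability (borelType X) R).
Context (l1 lm1 : R -> R) (c1 cm1 : X * X -> R) (cX : compact [set: X])
  (cl1 : continuous l1) (clm1 : continuous lm1)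
  (cc1 : continuous c1) (ccm1 : continuous cm1)
  (l1_ge0 : forall t, 0 <= l1 t) (lm1_ge0 : forall t, 0 <= lm1 t)
  (c1_ge0 : forall p, 0 <= c1 p) (cm1_ge0 : forall p, 0 <= cm1 p)
  (c1_diag : forall x, c1 (x, x) = 0) (cm1_diag : forall x, cm1 (x, x) = 0).

Definition total_risk (h : X -> R) : \bar R :=
  (adv_risk mu1 l1 c1 h + adv_risk mum1 lm1 cm1 h)%E.

Lemma total_risk_fin_num h : continuous h -> total_risk h \is a fin_num.
Proof. by move=> ch; rewrite fin_numD !adv_risk_fin_num. Qed.

(** The inner map [f] varies and the outer map [a] is fixed, because the
    minimization takes place over the transforms [psi] and not over the
    classifiers [a \o psi]. *)
Lemma total_risk_uniform_dist (a : R -> R) f (e : R) :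
  continuous a -> continuous f -> 0 < e -> exists2 d : R, 0 < d &
    forall g : X -> R, continuous g -> (forall x, `|f x - g x| < d) ->
      `|fine (total_risk (a \o f)) - fine (total_risk (a \o g))| <= e.
Proof.
move=> ca cf e0; have e2 : 0 < e / 2 by rewrite divr_gt0.
have ccomp (u v : R -> R) : continuous u -> continuous v -> continuous (u \o v).
  by move=> cu cv x; apply: continuous_comp; [exact: cv|exact: cu].
have [d1 d10 f1] := comp_uniform_dist cX cf (ccomp _ _ cl1 ca) e2.
have [d2 d20 f2] := comp_uniform_dist cX cf (ccomp _ _ clm1 ca) e2.
exists (Num.min d1 d2); first by rewrite lt_min d10.
move=> g cg fg.
have {}f1 x : `|l1 (a (f x)) - l1 (a (g x))| <= e / 2.
  by apply: f1 => y; have := fg y; rewrite lt_min => /andP[].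
have {}f2 x : `|lm1 (a (f x)) - lm1 (a (g x))| <= e / 2.
  by apply: f2 => y; have := fg y; rewrite lt_min => /andP[].
have caf : continuous (a \o f).
  by move=> x; apply: continuous_comp; [exact: cf|exact: ca].
have cag : continuous (a \o g).
  by move=> x; apply: continuous_comp; [exact: cg|exact: ca].
have key h h' : continuous h -> continuous h' ->
    (forall x, `|l1 (h x) - l1 (h' x)| <= e / 2) ->
    (forall x, `|lm1 (h x) - lm1 (h' x)| <= e / 2) ->
    fine (total_risk h) <= fine (total_risk h') + e.
  move=> ch ch' h1 h2; rewrite -lee_fin EFinD !fineK ?total_risk_fin_num//.
  rewrite [in e%:E](splitr e) EFinD addeACA; apply: leeD.
    apply: adv_risk_le => //; first exact: ltW.
    by move=> z; have := h1 z; rewrite ler_norml => /andP[_]; lra.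
  apply: adv_risk_le => //; first exact: ltW.
  by move=> z; have := h2 z; rewrite ler_norml => /andP[_]; lra.
have h1 := key _ _ caf cag f1 f2.
have h2 : fine (total_risk (a \o g)) <= fine (total_risk (a \o f)) + e.
  by apply: key => // x; rewrite distrC; [exact: f1|exact: f2].
by rewrite ler_norml; apply/andP; split; lra.
Qed.

End Classifier.

Unset Implicit Arguments.

Theorem theorem4p3 (R : realType) (X : pointedMetricType R)
    (mu1 mum1 : probability (borelType X) R)
    (l1 lm1 : R -> R) (c1 cm1 : X * X -> R)
    (compactX : compact [set: X])
    (l1_ge0 : forall t, 0 <= l1 t)
    (lm1_ge0 : forall t, 0 <= lm1 t)
    (l1_convex : convex_function (setT : set R) l1)
    (lm1_convex : convex_function (setT : set R) lm1)
    (c1_ge0 : forall p, 0 <= c1 p)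
    (cm1_ge0 : forall p, 0 <= cm1 p)
    (c1_diag : forall x, c1 (x, x) = 0)
    (cm1_diag : forall x, cm1 (x, x) = 0)
    (c1_cts : continuous c1)
    (cm1_cts : continuous cm1)
    (l1_noninc : nonincreasing_fun l1)
    (lm1_nondec : nondecreasing_fun lm1)
    (l1_lim : l1 t @[t --> -oo] --> +oo)
    (lm1_lim : lm1 t @[t --> +oo] --> +oo) :
  exists h : X -> R, continuous h /\
    forall g : X -> R, continuous g ->
      (adv_risk mu1 l1 c1 h + adv_risk mum1 lm1 cm1 h <=
       adv_risk mu1 l1 c1 g + adv_risk mum1 lm1 cm1 g)%E.
Proof.
have l1_cts := convex_function_continuous l1_convex.
have lm1_cts := convex_function_continuous lm1_convex.
pose J := total_risk mu1 mum1 l1 lm1 c1 cm1.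
have J_fin g : continuous g -> J g \is a fin_num by exact: total_risk_fin_num.
pose g0 : X -> R := cst 0.
have g0_cts : continuous g0 by move=> x; exact: cvg_cst.
(* [A] and [B] bound every classifier that does at least as well as [g0]. *)
have [C1 c1C] := cost_bounded compactX c1_cts.
have [Cm cmC] := cost_bounded compactX cm1_cts.
have [A lA] : exists A, fine (J g0) + C1 < l1 A.
  exact: (filter_ex (cvgry_gt l1_lim (fine (J g0) + C1))).
have [B lB] : exists B, fine (J g0) + Cm < lm1 B.
  exact: (filter_ex (cvgry_gt lm1_lim (fine (J g0) + Cm))).
have bounded g : continuous g -> (J g <= J g0)%E -> forall z, A <= g z <= B.
  move=> cg Jg z.
  have Jg1 : (adv_risk mu1 l1 c1 g <= (fine (J g0))%:E)%E.
    by rewrite fineK ?J_fin//; apply: le_trans Jg; rewrite leeDl// adv_risk_ge0.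
  have Jgm : (adv_risk mum1 lm1 cm1 g <= (fine (J g0))%:E)%E.
    by rewrite fineK ?J_fin//; apply: le_trans Jg; rewrite leeDr// adv_risk_ge0.
  apply/andP; split; rewrite leNgt; apply/negP.
    move=> /ltW/l1_noninc; apply/negP; rewrite -ltNge; apply: le_lt_trans lA.
    rewrite -lee_fin EFinD.
    have := le_adv_risk mu1 compactX l1_cts c1_cts l1_ge0 c1_ge0 c1_diag z cg c1C.
    by move=> /le_trans; apply; exact: leeD.
  move=> /ltW/lm1_nondec; apply/negP; rewrite -ltNge; apply: le_lt_trans lB.
  rewrite -lee_fin EFinD.
  have := le_adv_risk mum1 compactX lm1_cts cm1_cts lm1_ge0 cm1_ge0 cm1_diag z cg cmC.
  by move=> /le_trans; apply; exact: leeD.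
(* The competitor [g0] itself lies between [A] and [B]. *)
have AB : A <= B.
  by have /andP[] := bounded g0 g0_cts (lexx _) point; exact: le_trans.
have [a [a_cts la amin]] := nonincreasing_convex_inverse l1_convex l1_noninc AB.
pose omega := cost_modulus (swap_cost c1).
pose K := equicontinuous_family (l1 B) (l1 A) omega.
have omega_small x (e : R) : 0 < e -> \forall y \near x, omega x y <= e.
  exact: (cost_modulus_small compactX (swap_cost_continuous c1_cts)).
have K_cts f : K f -> continuous f.
  exact: (equicontinuous_family_continuous omega_small).
have aK_cts f : K f -> continuous (a \o f).
  move=> /K_cts f_cts x; apply: continuous_comp; [exact: f_cts|exact: a_cts].
have improve g : continuous g -> (J g <= J g0)%E ->
    exists2 psi, K psi & (J (a \o psi) <= J g)%E.
  move=> cg Jg.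
  have [psi [psiK apsi advpsi]] := equicontinuous_replacement compactX l1_cts
    l1_noninc c1_cts c1_ge0 c1_diag la amin cg (bounded g cg Jg).
  exists psi => //; apply: leeD; rewrite -[leRHS]adde0.
    apply: adv_risk_le_adv_loss => //; first exact: aK_cts.
    by move=> x; rewrite addr0.
  apply: adv_risk_le => //; first exact: aK_cts.
  by move=> z; rewrite addr0; exact: lm1_nondec (apsi z).
have [|f e fK e0|f fK fmin] := equicontinuous_family_argmin compactX omega_small
    (F := fun psi => fine (J (a \o psi))) (p := l1 B) (q := l1 A).
- by have [psi psiK _] := improve g0 g0_cts (lexx _); exists psi.
- have [d d0 dP] := total_risk_uniform_dist mu1 mum1 compactX l1_cts lm1_cts c1_cts
    cm1_cts l1_ge0 lm1_ge0 c1_ge0 cm1_ge0 c1_diag cm1_diag a_cts (K_cts f fK) e0.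
  by exists d => // g gK; apply: dP; exact: K_cts.
exists (a \o f); split=> [|g cg]; first exact: aK_cts.
have Jmin g' : continuous g' -> (J g' <= J g0)%E -> (J (a \o f) <= J g')%E.
  move=> cg' /(improve _ cg')[psi psiK]; apply: le_trans.
  by rewrite -(fineK (J_fin _ (aK_cts _ fK))) -(fineK (J_fin _ (aK_cts _ psiK))) lee_fin fmin.
have [|/ltW] := leP (J g) (J g0); first exact: Jmin.
by apply: le_trans; exact: Jmin.
Qed.
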